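(* Let $H=(V,E)$ be a finite hypergraph with $E\neq\emptyset$ and $\emptyset\notin E$. For any integer $j$ with $0\le j\le dt(H)$, $$dt(H)\ge \frac{|E|-T[H,j]}{\check{\delta}(H)}+j.$$ Consequently, for any such $j$, $$dt(H)\ge \frac{|E|-2^j+1}{\check{\delta}(H)}+j.$$
   Context: A hypergraph $H=(V,E)$ has a finite vertex set $V$ and a set $E$ of subsets of $V$ (edges; no multiple edges). For $S\subseteq V$ and $e\in E$, the trace of $e$ on $S$ is $e\cap S$. The induced subhypergraph $H[S]$ is the hypergraph on vertex set $S$ whose edges are the distinct traces of edges of $H$ on $S$. The degree of a vertex is the number of edges containing it. The pseudo induced subhypergraph of $H$ on $S$ has vertex set $S$ and edge set $\{e\in E: e\subseteq S\}$. The pseudo degeneracy $\delta^*(H)$ is the largest minimum degree over all pseudo induced subhypergraphs of $H$ (with non-empty vertex set). The reduced degeneracy $\check{\delta}(H)$ is the largest pseudo degeneracy $\delta^*(H[U])$ over all induced subhypergraphs $H[U]$, $\emptyset\neq U\subseteq V$. The trace function $T[H,k]$ is the largest number of distinct non-empty traces of edges of $H$ on a set $S\subseteq V$ with $|S|=k$. A set $S\subseteq V$ is a transversal if $e\cap S\neq\emptyset$ for all $e\in E$, and is distinguishing if any two distinct edges of $H$ have different traces on $S$. The distinguishing transversal number $dt(H)$ is the minimum size of a set that is both distinguishing and a transversal. *)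

(* Defs.v *)
From HB Require Import structures.
From mathcomp Require Import all_boot all_order all_algebra.

Set Implicit Arguments.
Unset Strict Implicit.
Unset Printing Implicit Defensive.

(* The vertices lie in an ambient finite type T; the vertex set is an explicit
   component, since (pseudo) induced subhypergraphs shrink it. *)
Record hypergraph (T : finType) := Hypergraph {
  vset : {set T};
  edges : {set {set T}};
  edges_sub : edges \subset powerset vset
}.

Section HypergraphDefs.

Variable T : finType.
Implicit Types (H : hypergraph T) (S U : {set T}).

Definition traces H S : {set {set T}} := [set e :&: S | e in edges H].

Fact traces_sub H S : traces H S \subset powerset S.
Proof.
by apply/subsetP => f /imsetP[e _ ->]; rewrite powersetE subsetIr.
Qed.

Definition induced H S : hypergraph T := Hypergraph (traces_sub H S).

Fact pseudo_sub H S : [set e in edges H | e \subset S] \subset powerset S.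
Proof. by apply/subsetP => e; rewrite inE powersetE => /andP[]. Qed.

Definition pseudo_induced H S : hypergraph T := Hypergraph (pseudo_sub H S).

Definition degree H (x : T) : nat := #|[set e in edges H | x \in e]|.

(* Every degree is at most #|edges H|, so that initial value does not affect
   the minimum when the vertex set is non-empty. *)
Definition min_degree H : nat :=
  \big[minn/#|edges H|]_(x in vset H) degree H x.

Definition pseudo_degeneracy H : nat :=
  \max_(S : {set T} | (S \subset vset H) && (S != set0))
    min_degree (pseudo_induced H S).

Definition reduced_degeneracy H : nat :=
  \max_(U : {set T} | (U \subset vset H) && (U != set0))
    pseudo_degeneracy (induced H U).

(* Meaningful for k <= #|vset H|; otherwise the maximum is over no sets
   and is 0. *)
Definition trace_function H (k : nat) : nat :=
  \max_(S : {set T} | (S \subset vset H) && (#|S| == k)) #|traces H S :\ set0|.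

Definition transversal H S : bool :=
  [forall e in edges H, e :&: S != set0].

Definition distinguishing H S : bool :=
  [forall e in edges H, forall f in edges H,
     (e != f) ==> (e :&: S != f :&: S)].

Definition distinguishing_transversal H S : bool :=
  [&& S \subset vset H, distinguishing H S & transversal H S].

(* When set0 is not an edge, vset H is a distinguishing transversal (proved
   below), so the arg min is over a non-empty family. *)
Definition dt H : nat :=
  #|[arg min_(S < vset H | distinguishing_transversal H S) #|S|]|.

Lemma distinguishing_transversal_vset H :
  set0 \notin edges H -> distinguishing_transversal H (vset H).
Proof.
move=> H0; have EV e : e \in edges H -> e :&: vset H = e.
  by move=> /(subsetP (edges_sub H)); rewrite powersetE => /setIidPl.
apply/and3P; split=> //.
  apply/forall_inP => e He; apply/forall_inP => f Hf.
  by rewrite !EV //; apply/implyP.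
by apply/forall_inP => e He; rewrite EV //; apply: contraNneq H0 => <-.
Qed.

End HypergraphDefs.

(* Main.v *)
(** Let S be a minimum distinguishing transversal. The trace H[S] has |E|
    non-empty edges. Deleting from S, one at a time, a vertex of minimum degree
    in the current pseudo induced subhypergraph of H[S] destroys at most
    δ*(H[S]) edges per step. The edges left when j vertices remain are non-empty
    traces of H on those j vertices, so there are at most T[H,j] of them, whence
    |E| <= T[H,j] + (dt(H) - j) δ*(H[S]). *)
Require Import Defs.
From HB Require Import structures.
From mathcomp Require Import all_boot all_order all_algebra.
Import Order.TTheory GRing.Theory Num.Theory.
Local Open Scope ring_scope.

Lemma degree_le_card_edges (T : finType) (H : hypergraph T) (x : T) :
  (degree H x <= #|edges H|)%N.
Proof. by apply/subset_leq_card/subsetP => e; rewrite inE => /andP[]. Qed.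

Lemma exists_degree_le_min_degree (T : finType) (H : hypergraph T) :
  vset H != set0 -> exists2 x, x \in vset H & (degree H x <= min_degree H)%N.
Proof.
case/set0Pn => x0 Vx0.
case: (arg_minnP (degree H) Vx0) => x Vx le_x; exists x => //.
apply: (big_ind (fun m => degree H x <= m)%N) => [|m n mx nx|//].
  exact: degree_le_card_edges.
by rewrite leq_min mx.
Qed.

(** An edge inside [S] either contains [x], and is counted by the degree, or avoids [x], and then
    lies inside [S :\ x]. *)
Lemma pseudo_induced_delete (T : finType) (H : hypergraph T) (S : {set T}) x :
  #|edges (pseudo_induced H S)| =
    (degree (pseudo_induced H S) x
     + #|edges (pseudo_induced H (S :\ x))|)%N.
Proof.
rewrite -(cardsID [set e : {set T} | x \in e]); congr (_ + _)%N.
  by apply: eq_card => e; rewrite !inE.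
by apply: eq_card => e; rewrite !inE subsetD1 andbC -andbA.
Qed.

Lemma card_pseudo_induced_le (T : finType) (H : hypergraph T) (S : {set T})
    (j : nat) :
  S \subset vset H -> (j <= #|S|)%N ->
  exists R : {set T}, [/\ R \subset S, #|R| = j &
    (#|edges (pseudo_induced H S)|
      <= #|edges (pseudo_induced H R)| + (#|S| - j) * pseudo_degeneracy H)%N].
Proof.
(* Induction on the number [n] of vertices still to be deleted, for all [S] at once. *)
move=> + le_j; move: {2}(#|S| - j)%N (erefl (#|S| - j)%N) => n.
elim: n S le_j => [|n IHn] S le_j Sn sSV.
  exists S; split; rewrite ?leq_addr //.
  by apply/eqP; rewrite eqn_leq le_j -subn_eq0 Sn.
have S0 : S != set0 by apply: contra_eq_neq Sn => ->; rewrite cards0.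
have [x Sx deg_x] := @exists_degree_le_min_degree _ (pseudo_induced H S) S0.
have cSx : #|S| = #|S :\ x|.+1 by rewrite (cardsD1 x S) Sx.
have lt_j : (j < #|S|)%N by rewrite -subn_gt0 Sn.
have le_j' : (j <= #|S :\ x|)%N by rewrite cSx in lt_j.
have Sn' : (#|S :\ x| - j)%N = n.
  by move: Sn; rewrite cSx subSn // => -[].
have [R [sR cR leR]] := IHn _ le_j' Sn' (subset_trans (subD1set S x) sSV).
exists R; split=> //; first exact: subset_trans sR (subD1set S x).
(* The edges lost with [x] are charged to one copy of [pseudo_degeneracy H], the later losses to the
   other [n] copies. *)
rewrite (pseudo_induced_delete T H S x) Sn mulSn addnCA leq_add //.
  apply: leq_trans deg_x _.
  apply: (leq_bigmax_cond (F := fun S => min_degree (pseudo_induced H S))).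
  by rewrite sSV.
by rewrite -Sn'.
Qed.

Lemma card_edges_le (T : finType) (H : hypergraph T) (j : nat) :
  edges H != set0 -> set0 \notin edges H -> (j <= dt H)%N ->
  (#|edges H| <= trace_function H j + (dt H - j) * reduced_degeneracy H)%N.
Proof.
move=> E0 H0; rewrite /dt.
case: (arg_minnP (fun S : {set T} => #|S|)
  (distinguishing_transversal_vset H0)) => S /and3P[sSV dS tS] _ le_j.
(* Non-emptiness makes [S] an admissible [U] in the maximum defining [reduced_degeneracy]. *)
have S0 : S != set0.
  have [e Ee] := set0Pn _ E0.
  by apply: contraNneq (forall_inP tS e Ee) => ->; rewrite setI0.
have inj : {in edges H &, injective (fun e => e :&: S)}.
  move=> e f Ee Ef eSf; apply/eqP; apply: contraT => nef.
  move: (implyP (forall_inP (forall_inP dS e Ee) f Ef) nef).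
  by rewrite eSf eqxx.
(* Distinct edges have distinct traces on [S], and restricting H[S] to its whole vertex set discards
   none of them. *)
have -> : #|edges H| = #|edges (pseudo_induced (induced H S) S)|.
  rewrite -(card_in_imset inj); apply: eq_card => f; rewrite !inE.
  by apply/idP/andP => [Ef|[]//]; split=> //; case/imsetP: Ef => e _ ->;
    rewrite subsetIr.
have [R [sRS cR leR]] :=
  @card_pseudo_induced_le _ (induced H S) S j (subxx S) le_j.
apply: leq_trans leR _; apply: leq_add.
  apply: leq_trans
    (leq_bigmax_cond (F := fun S => #|traces H S :\ set0|) R _); last first.
    by rewrite (subset_trans sRS sSV) cR eqxx.
  (* A trace e ∩ S contained in [R] equals e ∩ R; it is non-empty because [S] is a transversal. *)
  apply/subset_leq_card/subsetP => f; rewrite !inE => /andP[/imsetP[e Ee ->]] sR.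
  rewrite (forall_inP tS e Ee) /=; apply/imsetP; exists e => //.
  by rewrite -(setIidPl sR) -setIA (setIidPr sRS).
rewrite leq_mul2l; apply/orP; right.
apply: (leq_bigmax_cond (F := fun U => pseudo_degeneracy (induced H U))).
by rewrite sSV.
Qed.

(** The empty set is one of the 2^j subsets but is never counted; this strictness gives the +1 in
    the second bound. *)
Lemma trace_function_lt (T : finType) (H : hypergraph T) (j : nat) :
  (trace_function H j < 2 ^ j)%N.
Proof.
rewrite -(prednK (expn_gt0 2 j)) ltnS; apply/bigmax_leqP => S /andP[_ /eqP <-].
rewrite -card_powerset (cardsD1 set0) powersetE sub0set.
exact: subset_leq_card (setSD _ (traces_sub H S)).
Qed.

Theorem theorem2p1 (T : finType) (H : hypergraph T)
    (edges_neq0 : edges H != set0) (set0_notin : set0 \notin edges H)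
    (j : nat) (le_j_dt : (j <= dt H)%N) :
  (#|edges H|%:R - (trace_function H j)%:R) / (reduced_degeneracy H)%:R + j%:R
    <= (dt H)%:R :> rat
  /\
  (#|edges H|%:R - 2 ^+ j + 1) / (reduced_degeneracy H)%:R + j%:R
    <= (dt H)%:R :> rat.
Proof.
have main : (#|edges H|%:R - (trace_function H j)%:R)
    / (reduced_degeneracy H)%:R + j%:R <= (dt H)%:R :> rat.
  rewrite -lerBrDr -(natrB _ le_j_dt).
  have [->|d_gt0] := posnP (reduced_degeneracy H).
    (* As [0^-1 = 0] in [rat], only 0 <= dt(H) - j remains. *)
    by rewrite invr0 mulr0 ler0n.
  rewrite ler_pdivrMr ?ltr0n // lerBlDl -natrM -natrD ler_nat.
  exact: card_edges_le.
split=> //; apply: le_trans main.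
rewrite lerD2r ler_wpM2r ?invr_ge0 ?ler0n // -addrA lerD2l lerNr.
by rewrite opprD opprK lerBrDr -natrX natr1 ler_nat trace_function_lt.
Qed.
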